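(* Let $X$ be a separable infinite dimensional Banach space. Then $D(X)=\infty$.
   Context: For Banach spaces $X_1,X_2$ that are isomorphic, the Banach–Mazur distance is $d(X_1,X_2)=\inf\{\|T\|\,\|T^{-1}\|\}$, the infimum over all linear isomorphisms $T$ of $X_1$ onto $X_2$. For a Banach space $X$, $D(X)=\sup\{d(X_1,X_2): X_1, X_2 \text{ are Banach spaces isomorphic to } X\}$. Scalars are real. *)

(* Defs.v *)
From HB Require Import structures.
From mathcomp Require Import all_boot all_order all_algebra.
From mathcomp Require Import all_classical all_reals all_analysis.
Set Implicit Arguments. Unset Strict Implicit. Unset Printing Implicit Defensive.
Import Order.TTheory GRing.Theory Num.Theory.
Import numFieldNormedType.Exports.
Local Open Scope classical_set_scope.
Local Open Scope ring_scope.

Definition opnorm {R : realType} {X Y : normedModType R} (f : X -> Y) : \bar R :=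
  ereal_sup [set (`|f x|)%:E | x in [set x : X | `|x| <= 1]].

Definition lin_iso {R : realType} {X Y : normedModType R} (f : X -> Y) (g : Y -> X)
  : Prop :=
  linear f /\ cancel f g /\ cancel g f /\ continuous f /\ continuous g.

Definition isomorphic {R : realType} (X Y : normedModType R) : Prop :=
  exists (f : X -> Y) (g : Y -> X), lin_iso f g.

Definition bm_dist {R : realType} (X1 X2 : normedModType R) : \bar R :=
  ereal_inf [set r : \bar R | exists (f : X1 -> X2) (g : X2 -> X1),
             lin_iso f g /\ r = (opnorm f * opnorm g)%E].

Definition BM_D {R : realType} (X : completeNormedModType R) : \bar R :=
  ereal_sup [set r : \bar R | exists X1 X2 : completeNormedModType R,
    isomorphic X X1 /\ isomorphic X X2 /\ r = bm_dist X1 X2].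

Definition separable {T : topologicalType} : Prop :=
  exists S : set T, countable S /\ dense S.

Definition finite_dimensional {R : realType} (X : normedModType R) : Prop :=
  exists (n : nat) (v : 'I_n -> X),
    forall x : X, exists c : 'I_n -> R, x = \sum_(i < n) c i *: v i.

(* Main.v *)
Require Import Defs.
From HB Require Import structures.
From mathcomp Require Import all_boot all_order all_algebra.
From mathcomp Require Import all_classical all_reals all_analysis.
From mathcomp Require Import ring lra.
Import Order.TTheory GRing.Theory Num.Theory.
Import numFieldNormedType.Exports.
Set Implicit Arguments. Unset Strict Implicit. Unset Printing Implicit Defensive.
Local Open Scope classical_set_scope.
Local Open Scope ring_scope.

(** Fix n.  Take an almost biorthogonal system (x_s, f_s), with (f_s) bounded,
    indexed by the finite sequences s of integers, and renorm X by the sums of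
    f_s over the branches of length n.  Given a branch p and, at each of its
    steps, a sibling, let y_i be the i-th node of p minus its sibling.  In the
    new norm the sum of the y_i has norm about n, whereas their alternating sum
    has norm at most 3, whatever the siblings are.

    On the other hand X has an equivalent norm in which every sequence of n
    blocks is 2-unconditional: take the supremum over all multipliers of
    variation at most 2n, and note that switching signs n times changes the
    variation by at most 2n, which is absorbed by a factor 2.  Blocks make sense
    without a basis because, X being separable, the identity of the dual ball is
    the pointwise limit, uniform over the ball, of self-maps of finite range.

    If T maps the first space onto the second, then by the pigeonhole principle
    the nodes and siblings can be chosen so that the T y_i are almost blocks.
    Comparing the two sums gives n - 1 <= 7 |T| |T^-1|. *)

(** * Norming functionals *)

Section sublinear.
Context {R : realType} {X : lmodType R}.

Definition sublinear (p : X -> R) : Prop :=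
  (forall x y, p (x + y) <= p x + p y) /\
  (forall (c : R) x, 0 <= c -> p (c *: x) = c * p x).

(** For sublinear [p], [t = 0] keeps this below [p], and [t = 1] makes it at most [- p x0] at
    [- x0]. A linear functional below it therefore agrees with [p] at [x0]. *)
Definition sublinear_shift (p : X -> R) (x0 x : X) : R :=
  inf [set p (x + t *: x0) - t * p x0 | t in [set t : R | 0 <= t]].

Lemma sublinear0 p : sublinear p -> p 0 = 0.
Proof. by move=> [_ pZ]; rewrite -(scale0r 0) pZ ?mul0r. Qed.

Lemma sublinear_shift_le p x0 x (t : R) : sublinear p -> 0 <= t ->
  sublinear_shift p x0 x <= p (x + t *: x0) - t * p x0.
Proof.
move=> [pD pZ] t0; apply: ge_inf; last by exists t.
exists (- p (- x)) => _ [s s0 <-].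
have := pD (x + s *: x0) (- x); rewrite addrAC subrr add0r pZ//; lra.
Qed.

Lemma sublinear_shift_ge p x0 x (c : R) :
  (forall t, 0 <= t -> c <= p (x + t *: x0) - t * p x0) ->
  c <= sublinear_shift p x0 x.
Proof.
move=> h; apply: lb_le_inf; last by move=> _ [t t0 <-]; exact: h.
by exists (p (x + 0 *: x0) - 0 * p x0); exists 0 => /=.
Qed.

Lemma sublinear_shift_sublinear p x0 :
  sublinear p -> sublinear (sublinear_shift p x0).
Proof.
move=> sp; have [pD pZ] := sp.
have shZ (c : R) x : 0 < c ->
    sublinear_shift p x0 (c *: x) <= c * sublinear_shift p x0 x.
  move=> c0; rewrite -ler_pdivrMl//; apply: sublinear_shift_ge => t t0.
  rewrite ler_pdivrMl//.
  have := sublinear_shift_le x0 (c *: x) sp (mulr_ge0 (ltW c0) t0).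
  by rewrite -scalerA -scalerDr (pZ c _ (ltW c0)) mulrBr mulrA.
split=> [x y|c x].
  rewrite -lerBlDr; apply: sublinear_shift_ge => t t0.
  rewrite lerBlDr -lerBlDl; apply: sublinear_shift_ge => s s0.
  have := sublinear_shift_le x0 (x + y) sp (addr_ge0 t0 s0).
  have := pD (x + t *: x0) (y + s *: x0).
  rewrite addrACA -scalerDl; lra.
rewrite le_eqVlt => /predU1P[<-|c0].
  rewrite scale0r mul0r; apply/eqP; rewrite eq_le; apply/andP; split.
    by have := sublinear_shift_le x0 0 sp (lexx 0);
      rewrite scale0r addr0 (sublinear0 sp) mul0r subr0.
  by apply: sublinear_shift_ge => t t0; rewrite add0r pZ// subrr.
apply/eqP; rewrite eq_le shZ//= -ler_pdivlMl//.
by rewrite -{1}(scalerK (lt0r_neq0 c0) x) shZ// invr_gt0.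
Qed.

(** Minimality gives [sublinear_shift p x = p] for every [x]. Read at [- x], this makes [p] odd, and
    an odd sublinear function is linear. *)
Lemma sublinear_minimal_linear p : sublinear p ->
  (forall q, sublinear q -> (forall x, q x <= p x) -> q = p) ->
  scalar p.
Proof.
move=> sp pmin; have [pD pZ] := sp.
have pN x : p (- x) = - p x.
  have /(congr1 (@^~ (- x))) : sublinear_shift p x = p.
    apply: pmin => [|y]; first exact: sublinear_shift_sublinear.
    by have := sublinear_shift_le x y sp (lexx 0);
      rewrite scale0r addr0 mul0r subr0.
  have := sublinear_shift_le x (- x) sp ler01.
  rewrite scale1r addNr (sublinear0 sp) => + E; rewrite E.
  have := pD x (- x); rewrite subrr (sublinear0 sp); lra.
have pA x y : p (x + y) = p x + p y.
  apply/eqP; rewrite eq_le pD/=.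
  have := pD (x + y) (- y); rewrite pN addrK; lra.
move=> a x y; rewrite /= pA; congr (_ + _).
have [a0|a0] := leP 0 a; first exact: pZ.
by rewrite -[a]opprK scaleNr pN pZ ?oppr_ge0 ?(ltW a0)// !mulNr opprK.
Qed.

(** Hahn-Banach by Zorn: a nonempty chain is bounded by its pointwise infimum, and a minimal element
    is linear. *)
Lemma sublinear_minorant_exists p : sublinear p ->
  exists f : X -> R, scalar f /\
    forall x, f x <= p x.
Proof.
move=> sp.
pose T := {q : X -> R | sublinear q /\ forall x, q x <= p x}.
(* The order is reversed, so that Zorn's maximal element is a minimal sublinear function. *)
pose r (q1 q2 : T) := `[< forall x, sval q2 x <= sval q1 x >].
have [||C tC|[f [sf fp]] fmax] := @ZL_preorder T (exist _ p (conj sp (fun=> lexx _))) r.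
- by move=> q; apply/asboolP => x.
- by move=> q1 q2 q3 /asboolP h1 /asboolP h2; apply/asboolP => x;
    exact: le_trans (h2 x) (h1 x).
- have [->|/set0P[c0 Cc0]] := eqVneq C set0.
    by exists (exist _ p (conj sp (fun=> lexx _))).
  pose A x := [set sval c x | c in C].
  have Alb x : has_lbound (A x).
    exists (- p (- x)) => _ [[c [[cD cZ] cp]] Cc <-] /=.
    have := cD x (- x); have := cp (- x).
    rewrite subrr (sublinear0 (conj cD cZ)); lra.
  have A0 x : A x !=set0 by exists (sval c0 x), c0.
  have infle x c : C c -> inf (A x) <= sval c x.
    by move=> Cc; apply: ge_inf => //; exists c.
  have sq : sublinear (fun x => inf (A x)).
    split=> [x y|c x].
      rewrite -lerBlDr; apply: lb_le_inf => // _ [c Cc <-].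
      rewrite lerBlDr -lerBlDl; apply: lb_le_inf => // _ [d Cd <-].
      rewrite lerBlDl.
      (* The smaller of [c] and [d] can replace both, and it is itself subadditive. *)
      have [/asboolP cd|/asboolP dc] := tC _ _ Cc Cd.
        apply: le_trans (infle _ _ Cd) _.
        have [[dD _] _] := svalP d; apply: le_trans (dD x y) _.
        by rewrite lerD2r.
      apply: le_trans (infle _ _ Cc) _.
      have [[cD _] _] := svalP c; apply: le_trans (cD x y) _.
      by rewrite lerD2l.
    rewrite le_eqVlt => /predU1P[<-|c0'].
      rewrite scale0r mul0r; apply/eqP; rewrite eq_le; apply/andP; split.
        by have := infle 0 _ Cc0; rewrite (sublinear0 (svalP c0).1).
      by apply: lb_le_inf => // _ [d _ <-]; rewrite (sublinear0 (svalP d).1).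
    apply/eqP; rewrite eq_le; apply/andP; split.
      rewrite -ler_pdivrMl//; apply: lb_le_inf => // _ [d Cd <-].
      rewrite ler_pdivrMl//; apply: le_trans (infle _ _ Cd) _.
      by rewrite (svalP d).1.2// ltW.
    apply: lb_le_inf => // _ [d Cd <-].
    rewrite (svalP d).1.2 ?(ltW c0')// ler_pM2l//; exact: infle.
  have qp x : inf (A x) <= p x := le_trans (infle x _ Cc0) ((svalP c0).2 x).
  exists (exist _ (fun x => inf (A x)) (conj sq qp)).
  by move=> c Cc; apply/asboolP => x /=; exact: infle.
exists f; split=> //; apply: sublinear_minimal_linear => // q sq qf.
have qp x : q x <= p x by exact: le_trans (qf x) (fp x).
have /asboolP/= h := fmax (exist _ q (conj sq qp)) (asboolT qf).
by apply/funext => x; apply/eqP; rewrite eq_le qf h.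
Qed.
End sublinear.

Section scalar_functions.
Context {R : realType} {X : lmodType R} (f : X -> R) (fl : scalar f).

Let g : {scalar X} := HB.pack f (GRing.isLinear.Build R X R *%R f fl).

Lemma scalar_addr x y : f (x + y) = f x + f y. Proof. exact: (raddfD g). Qed.

Lemma scalar_oppr x : f (- x) = - f x. Proof. exact: (raddfN g). Qed.

Lemma scalar_subr x y : f (x - y) = f x - f y. Proof. exact: (raddfB g). Qed.

Lemma scalar_scaler (a : R) x : f (a *: x) = a * f x.
Proof. exact: (linearZ_LR g). Qed.

Lemma scalar_sum (I : Type) (r : seq I) (P : pred I) (F : I -> X) :
  f (\sum_(i <- r | P i) F i) = \sum_(i <- r | P i) f (F i).
Proof. exact: (raddf_sum g). Qed.

End scalar_functions.

Section dual_ball.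
Context {R : realType} {X : normedModType R}.

Definition dual_ball (f : X -> R) : Prop :=
  scalar f /\
  (forall x, `|f x| <= `|x|).

(** Any linear minorant of the norm shifted along [x] works. *)
Lemma norming_functional (x : X) : exists2 f, dual_ball f & f x = `|x|.
Proof.
have sn : sublinear (fun y : X => `|y|).
  by split=> [y z|c y c0]; [exact: ler_normD | rewrite normrZ ger0_norm].
have [f [fl fp]] := sublinear_minorant_exists (sublinear_shift_sublinear x sn).
have fle y : f y <= `|y|.
  apply: le_trans (fp y) _; have := sublinear_shift_le x y sn (lexx 0).
  by rewrite scale0r addr0 mul0r subr0.
have fN y : f (- y) = - f y by exact: (scalar_oppr fl).
exists f.
  split=> // y; rewrite ler_norml fle andbT lerNl -fN.
  by apply: le_trans (fle _) _; rewrite normrN.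
apply/eqP; rewrite eq_le fle/=.
have := le_trans (fp (- x)) (sublinear_shift_le x (- x) sn ler01).
rewrite scale1r addNr normr0 fN; lra.
Qed.

End dual_ball.

(** * Finite-valued approximations of the dual ball *)

(** Induction on [gs]: the bounded range of the head is cut into slices of width [e], and the
    induction hypothesis gives a net inside each slice. *)
Lemma finite_net {R : realType} (T : Type) (gs : seq (T -> R)) (P : T -> Prop)
    (e : R) : 0 < e ->
  (forall g, List.In g gs -> exists b, forall t, P t -> `|g t| <= b) ->
  exists A : seq T, (forall t, List.In t A -> P t) /\
    forall t, P t -> exists2 a, List.In a A &
      forall g, List.In g gs -> `|g t - g a| <= e.
Proof.
move=> e0; elim: gs P => [|g gs IH] P bdd.
  have [[t0 Pt0]|nP] := pselect (exists t, P t).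
    exists [:: t0]; split=> [t [<-//|[]]|t _].
    by exists t0; first by left.
  by exists [::]; split=> [t []|t Pt]; case: nP; exists t.
have [b gb] := bdd g (or_introl erefl).
have sliced m : exists A : seq T, (forall t, List.In t A -> P t) /\
    forall t, P t -> g t + b < m%:R * e -> exists2 a, List.In a A &
      forall h, List.In h (g :: gs) -> `|h t - h a| <= e.
  elim: m => [|m [A [AP netA]]].
    exists [::]; split=> [t []|t /gb].
    by rewrite ler_norml mul0r => /andP[? _] ?; exfalso; lra.
  pose Q t := P t /\ m%:R * e <= g t + b < m.+1%:R * e.
  have [h hgs|B [BQ netB]] := IH Q.
    have [c hc] := bdd h (or_intror hgs); exists c => t [Pt _]; exact: hc.
  exists (A ++ B); split=> [t|t Pt tm].
    by move=> /List.in_app_iff[|/BQ[]//]; exact: AP.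
  have [tlt|tge] := ltP (g t + b) (m%:R * e).
    have [a Aa ha] := netA t Pt tlt.
    by exists a => //; apply/List.in_app_iff; left.
  have Qt : Q t by split=> //; rewrite tge.
  have [a Ba ha] := netB t Qt.
  exists a; first by apply/List.in_app_iff; right.
  move=> h [<-|]; last exact: ha.
  have [_ /andP[a1 a2]] := BQ _ Ba.
  move: tm a1 a2 tge; rewrite -natr1 mulrDl mul1r => *.
  by rewrite ler_norml; apply/andP; split; lra.
(* Since [g t + b] is at most [b + b], this many slices exhaust [P]. *)
have [A [AP netA]] := sliced (Num.truncn ((b + b) / e)).+1.
exists A; split=> // t Pt; apply: netA => //.
rewrite -ltr_pdivrMr//; apply: le_lt_trans (truncnS_gt _).
by rewrite ler_pM2r ?invr_gt0// lerD2r; have /ler_normlW := gb t Pt.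
Qed.

(** * Common kernels of finitely many functionals *)

Section finite_codimension.
Context {R : realType} {X : normedModType R}.

(** Induction on [A]: either the new functional vanishes on the kernel found so far, or one vector
    [w] of that kernel corrects its value without disturbing the others. *)
Lemma common_kernel_finite_codim (A : seq (X -> R)) :
  (forall f, List.In f A -> scalar f) ->
  exists s : seq X, forall x, exists c : nat -> R, forall f, List.In f A ->
    f (x - \sum_(i < size s) c i *: s`_i) = 0.
Proof.
elim: A => [|f A IH] lA; first by exists [::] => x; exists (fun=> 0).
have [g gA|s hs] := IH; first by apply: lA; right.
have fl := lA f (or_introl erefl).
have [[w [Aw fw]]|nw] :=
  pselect (exists w, (forall g, List.In g A -> g w = 0) /\ f w <> 0).
  exists (w :: s) => x; have [c hc] := hs x.
  set y := x - _ in hc.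
  exists (fun i => if i is j.+1 then c j else f y / f w) => g gA.
  rewrite /= big_ord_recl/= opprD addrCA addrC -/y.
  case: gA => [<-|gA].
    rewrite (scalar_subr fl) (scalar_scaler fl) divfK ?subrr//; exact/eqP.
  have gl : scalar g by apply: lA; right.
  by rewrite (scalar_subr gl) (scalar_scaler gl) (Aw g gA) mulr0 subr0 hc.
exists s => x; have [c hc] := hs x; exists c => g [<-|]; last exact: hc.
by apply: contrapT => fy; apply: nw; eexists; split; [exact: hc|exact: fy].
Qed.

Lemma unit_vector_in_common_kernel (A : seq (X -> R)) :
  ~ finite_dimensional X -> (forall f, List.In f A -> scalar f) ->
  exists2 x : X, `|x| = 1 & forall f, List.In f A -> f x = 0.
Proof.
move=> infX lA; have [s hs] := common_kernel_finite_codim lA.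
have [x [x0 Ax]] : exists x : X, x <> 0 /\ forall f, List.In f A -> f x = 0.
  apply: contrapT => h; apply: infX; exists (size s), (fun i => s`_i) => x.
  have [c hc] := hs x; exists (fun i => c i).
  apply/eqP; rewrite -subr_eq0; apply/eqP; apply: contrapT => y0.
  by apply: h; eexists; split; [exact: y0|exact: hc].
have nx0 : `|x| != 0 by rewrite normr_eq0; exact/eqP.
exists (`|x|^-1 *: x); first by rewrite normrZ normfV normr_id mulVf.
by move=> f Af; rewrite (scalar_scaler (lA f Af)) (Ax f Af) mulr0.
Qed.

End finite_codimension.

(** * Coarsenings of the dual ball *)

Section coarsening.
Context {R : realType} {X : normedModType R}.

Lemma dense_sequence : @separable X ->
  exists d : nat -> X, forall x (e : R), 0 < e -> exists m, `|x - d m| <= e.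
Proof.
move=> [S [/countable_injP[c cinj] dS]].
(* A number that codes no point of [S] gets the harmless value 0. *)
exists (fun m => xget 0 [set x | S x /\ c x = m]) => x e e0.
have [|y [xy Sy]] := dS (ball x e) _ (ball_open x _).
  by exists x; exact: ballxx.
exists (c y); have [Sz cz] : [set x | S x /\ c x = c y]
    (xget 0 [set x | S x /\ c x = c y]) by apply: (xgetPex 0); exists y.
have -> := cinj _ _ (mem_set Sz) (mem_set Sy) cz.
by apply: ltW; move: xy; rewrite -ball_normE.
Qed.

(* [phi k psi] plays the role of the functional [psi] composed with the [k]-th
   partial sum projection of a basis; [X] itself need not have one. *)
Definition coarsening (phi : nat -> (X -> R) -> X -> R) : Prop :=
  [/\ forall psi x, phi 0 psi x = 0,
      forall k psi, dual_ball psi -> dual_ball (phi k psi),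
      forall k, exists A, forall psi, dual_ball psi -> List.In (phi k psi) A &
      forall x (e : R), 0 < e -> exists K, forall k psi, (K <= k)%N -> dual_ball psi ->
        `|phi k psi x - psi x| <= e].

Lemma dual_ball0 : dual_ball (fun _ : X => 0 : R).
Proof. by split=> [a x y|x]; rewrite ?mulr0 ?addr0// normr0. Qed.

(** Level [k.+1] replaces [psi] by a member of a finite net for the values at the first [k] dense
    points. Members of the dual ball are 1-Lipschitz, so closeness at a dense point near [x] passes
    to [x], uniformly in [psi]. *)
Lemma coarsening_exists : @separable X -> exists phi, coarsening phi.
Proof.
move=> /dense_sequence[d dd].
have step k : exists A : seq (X -> R), (forall psi, List.In psi A -> dual_ball psi) /\
    forall psi, dual_ball psi -> exists2 a, List.In a A &
      forall i, (i < k)%N -> `|psi (d i) - a (d i)| <= k.+1%:R^-1.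
  pose ev i := (fun psi : X -> R => psi (d i)).
  have [||A [AB netA]] := @finite_net R _ [seq ev i | i <- iota 0 k] dual_ball
    (k.+1%:R^-1); first by rewrite invr_gt0.
    move=> g /List.in_map_iff[i [<- _]]; exists `|d i| => psi [_]; exact.
  exists A; split=> // psi Bpsi; have [a Aa ha] := netA psi Bpsi.
  exists a => // i ik; apply: (ha (ev i)); apply/List.in_map_iff; exists i.
  split=> //; have : i \in iota 0 k by rewrite mem_iota.
  by elim: (iota 0 k) => //= j s IH; rewrite inE => /predU1P[->|/IH]; auto.
have stepf k : exists F : (X -> R) -> X -> R, (exists A, forall psi, dual_ball psi ->
      List.In (F psi) A) /\ (forall psi, dual_ball psi -> dual_ball (F psi)) /\
    forall psi i, dual_ball psi -> (i < k)%N ->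
      `|F psi (d i) - psi (d i)| <= k.+1%:R^-1.
  have [A [AB netA]] := step k.
  have /choice[F hF] : forall psi, exists a, dual_ball psi -> List.In a A /\
      forall i, (i < k)%N -> `|psi (d i) - a (d i)| <= k.+1%:R^-1.
    move=> psi; have [B|nB] := pselect (dual_ball psi); last by exists psi.
    by have [a ? ?] := netA psi B; exists a.
  exists F; split; first by exists A => psi /hF[].
  split=> [psi /hF[/AB]//|psi i /hF[_ +] ik].
  by rewrite distrC; apply.
have [F hF] := choice stepf.
exists (fun k => if k is j.+1 then F j else fun=> fun=> 0); split=> //.
- by move=> [|k] psi B; [exact: dual_ball0|exact: (hF k).2.1].
- by move=> [|k]; [exists [:: fun=> 0] => psi _; left|exact: (hF k).1].
(* Error budget: [e / 4] for moving from [x] to [d m] under each of the two functionals, [e / 2] for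
   the net. *)
move=> x e e0; have [m xm] := dd x (e / 4) ltac:(lra).
exists (maxn m (Num.truncn (2 / e))).+2 => -[//|k] psi Kk B.
have mk : (m < k)%N by exact: leq_ltn_trans (leq_maxl _ _) Kk.
have ek : k.+1%:R^-1 <= e / 2.
  rewrite -[e / 2]invrK lef_pV2 ?posrE ?invr_gt0 ?divr_gt0// invf_div.
  apply: le_trans (ltW (truncnS_gt _)) _; rewrite ler_nat ltnS.
  exact: leq_trans (leq_maxr _ _) (ltnW Kk).
have h := le_trans ((hF k).2.2 psi m B mk) ek.
have [Bl Bn] := B; have [Fl Fn] := (hF k).2.1 psi B.
have h1 : `|F k psi (x - d m)| <= e / 4 by exact: le_trans (Fn _) xm.
have h2 : `|psi (x - d m)| <= e / 4 by exact: le_trans (Bn _) xm.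
move: h1 h2; rewrite (scalar_subr Fl) (scalar_subr Bl).
move: h; rewrite !ler_norml => /andP[? ?] /andP[? ?] /andP[? ?].
by apply/andP; split; lra.
Qed.

Lemma coarsening_finite_range phi K : coarsening phi ->
  exists A : seq (X -> R), (forall f, List.In f A -> dual_ball f) /\
    forall k psi, (k <= K)%N -> dual_ball psi -> List.In (phi k psi) A.
Proof.
move=> [_ ball_phi fin_phi _].
have fin k : exists A : seq (X -> R), (forall f, List.In f A -> dual_ball f) /\
    forall psi, dual_ball psi -> List.In (phi k psi) A.
  have [A hA] := fin_phi k.
  exists (List.filter (fun f => `[< dual_ball f >]) A); split=> [f|psi B].
    by move=> /List.filter_In[_ /asboolP].
  by apply/List.filter_In; split; [exact: hA|apply/asboolP; exact: ball_phi].
elim: K => [|K [A [AB hA]]].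
  have [A [AB hA]] := fin 0%N; exists A; split=> // k psi.
  by rewrite leqn0 => /eqP->; exact: hA.
have [C [CB hC]] := fin K.+1; exists (A ++ C); split=> [f|k psi].
  by move=> /List.in_app_iff[/AB|/CB].
rewrite leq_eqVlt => /predU1P[->|kK] B; apply/List.in_app_iff.
  by right; exact: hC.
by left; exact: hA.
Qed.

End coarsening.

(** * Almost biorthogonal systems and multipliers *)

Definition almost_biorthogonal {R : realType} {X : normedModType R} (eta : R)
    (x : nat -> X) (f : nat -> X -> R) : Prop :=
  [/\ forall m, `|x m| = 1, forall m, scalar (f m),
      forall m y, `|f m y| <= 2 * `|y| &
      forall m l, `|f m (x l) - (l == m)%:R| <= eta].

(** Gliding hump: [x m] is a unit vector killed by all levels up to [K m] and almost fully seen from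
    level [K m.+1] on; [f m] is the part, between these two levels, of a functional norming
    [x m]. *)
Lemma almost_biorthogonal_exists {R : realType} {X : normedModType R}
    (phi : nat -> (X -> R) -> X -> R) (eta : R) :
  coarsening phi -> ~ finite_dimensional X -> 0 < eta ->
  exists (x : nat -> X) f, almost_biorthogonal eta x f.
Proof.
move=> cphi infX eta0; have [phi0 phiB _ phic] := cphi.
have step k : exists u : X * (X -> R) * nat,
    [/\ `|u.1.1| = 1, dual_ball u.1.2, u.1.2 u.1.1 = 1, (k <= u.2)%N &
        (forall j psi, (j <= k)%N -> dual_ball psi -> phi j psi u.1.1 = 0) /\
        (forall j psi, (u.2 <= j)%N -> dual_ball psi ->
           `|phi j psi u.1.1 - psi u.1.1| <= eta / 2)].
  have [A [AB inA]] := coarsening_finite_range k cphi.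
  have [|y y1 Ay] := @unit_vector_in_common_kernel R X A infX.
    by move=> f /AB[].
  have [psi Bpsi psiy] := norming_functional y.
  have [|K hK] := phic y (eta / 2); first by rewrite divr_gt0.
  exists (y, psi, maxn k K); split=> //=; first by rewrite psiy.
    exact: leq_maxl.
  split=> [j p jk Bp|j p Kj Bp]; first by apply: Ay; exact: inA.
  by apply: hK => //; rewrite (leq_trans _ Kj)// leq_maxr.
have [u hu] := choice step.
pose K := fix K m := if m is j.+1 then (u (K j)).2 else 0%N.
pose x m := (u (K m)).1.1; pose psi m := (u (K m)).1.2.
have Kmono : {homo K : m l / (m <= l)%N}.
  apply: homo_leq => [//|? ? ? /leq_trans|m]; first exact.
  by have [_ _ _ + _] := hu (K m).
exists x, (fun m y => phi (K m.+1) (psi m) y - phi (K m) (psi m) y).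
have Bpsi m : dual_ball (psi m) by have [] := hu (K m).
split=> [m|m a y z|m y|m l].
- by have [] := hu (K m).
- have [l1 _] := phiB (K m.+1) _ (Bpsi m); have [l2 _] := phiB (K m) _ (Bpsi m).
  by rewrite l1 l2 /=; ring.
- have [_ b1] := phiB (K m.+1) _ (Bpsi m); have [_ b2] := phiB (K m) _ (Bpsi m).
  by apply: le_trans (ler_normB _ _) _; have := b1 y; have := b2 y; lra.
have [_ _ psix _ [kill near]] := hu (K l).
(* For [m < l] both levels kill [x l]; for [l < m] both are within [eta / 2] of the same value; on
   the diagonal only the upper level sees [x l]. *)
have [ml|lm|->] := ltngtP m l.
- rewrite !kill ?subrr ?normr0 ?ltW//; first exact: Kmono (ltnW ml).
  exact: (Kmono m.+1).
- have := near (K m.+1) _ (Kmono _ _ (leqW lm)) (Bpsi m).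
  have := near (K m) _ (Kmono _ _ lm) (Bpsi m).
  rewrite -/(x l) subr0 !ler_norml => /andP[? ?] /andP[? ?].
  by apply/andP; split; lra.
- have := near (K l.+1) _ (leqnn _) (Bpsi l).
  rewrite (kill (K l)) // subr0 -/(x l) (_ : psi l (x l) = 1)//.
  by move/le_trans; apply; lra.
Qed.

(** * Total variation and summation by parts *)

Section variation.
Context {R : realType}.

Definition seq_variation (N : nat) (th : nat -> R) : R :=
  \sum_(k < N) `|th k.+1 - th k|.

Lemma seq_variationB N a b :
  seq_variation N (fun k => a k - b k) <= seq_variation N a + seq_variation N b.
Proof.
rewrite -big_split/=; apply: ler_sum => k _.
rewrite (_ : a k.+1 - b k.+1 - (a k - b k) =
  (a k.+1 - a k) - (b k.+1 - b k)) ?ler_normB//; ring.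
Qed.

Lemma seq_variationM N a b : (forall k, `|a k| <= 1) -> (forall k, `|b k| <= 1) ->
  seq_variation N (fun k => a k * b k) <= seq_variation N a + seq_variation N b.
Proof.
move=> a1 b1; rewrite -big_split/=; apply: ler_sum => k _.
rewrite (_ : a k.+1 * b k.+1 - a k * b k =
  (a k.+1 - a k) * b k.+1 + a k * (b k.+1 - b k)); last ring.
apply: le_trans (ler_normD _ _) _; rewrite !normrM lerD//.
  by rewrite ler_piMr.
by rewrite ler_piMl.
Qed.

Lemma seq_variationZ N c a :
  seq_variation N (fun k => c * a k) = `|c| * seq_variation N a.
Proof.
by rewrite mulr_sumr; apply: eq_bigr => k _; rewrite -mulrBr normrM.
Qed.

(** Summation by parts moves the differences onto [th], so that only the size of [c] on the support
    of [th] and just after it matters. *)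
Lemma abel_summation_bound N (e s : R) (th c : nat -> R) :
  (forall k, `|th k| <= s) ->
  (forall k, th k != 0 -> `|c k| <= e /\ `|c k.+1| <= e) -> 0 <= e ->
  `|\sum_(k < N) th k * (c k.+1 - c k)| <= e * (2 * s + seq_variation N th).
Proof.
(* Large values of [c] only meet zero coefficients, so cutting them off leaves the sum unchanged and
   gives a global bound. *)
move=> ths thc e0; pose d k := if `|c k| <= e then c k else 0.
have de k : `|d k| <= e by rewrite /d; case: ifP => // _; rewrite normr0.
have -> : \sum_(k < N) th k * (c k.+1 - c k) = \sum_(k < N) th k * (d k.+1 - d k).
  apply: eq_bigr => k _; have [->|/thc[c1 c2]] := eqVneq (th k) 0.
    by rewrite !mul0r.
  by rewrite /d c1 c2.
have -> : \sum_(k < N) th k * (d k.+1 - d k) =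
    th N * d N - th 0 * d 0 - \sum_(k < N) (th k.+1 - th k) * d k.+1.
  elim: N => [|N IH]; first by rewrite !big_ord0; ring.
  by rewrite !big_ord_recr/= IH; ring.
have h k : `|th k * d k| <= e * s by rewrite normrM mulrC ler_pM.
have hs : `|\sum_(k < N) (th k.+1 - th k) * d k.+1| <= e * seq_variation N th.
  apply: le_trans (ler_norm_sum _ _ _) _.
  by rewrite mulr_sumr; apply: ler_sum => k _; rewrite normrM mulrC ler_wpM2r.
apply: le_trans (ler_normB _ _) _; rewrite mulrDr lerD//.
by apply: le_trans (ler_normB _ _) _; have := h N; have := h 0%N; lra.
Qed.

End variation.

Section multipliers.
Context {R : realType} {X : normedModType R}.
Variable phi : nat -> (X -> R) -> X -> R.
Hypothesis cphi : coarsening phi.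

(** With a basis, this would be [psi] at the vector obtained from [x] by multiplying its [k]-th
    coordinate by [th k]. *)
Definition multiplier (N : nat) (th : nat -> R) (psi : X -> R) (x : X) : R :=
  \sum_(k < N) th k * (phi k.+1 psi x - phi k psi x).

Definition multipliers (n : nat) : set (X -> R) :=
  [set l | exists N th psi, [/\ dual_ball psi, forall k, `|th k| <= 1,
    seq_variation N th <= 2 * n%:R & l = multiplier N th psi]].

Lemma multiplier_scalar N th psi : dual_ball psi -> scalar (multiplier N th psi).
Proof.
have [_ phiB _ _] := cphi.
move=> B a x y; rewrite /multiplier mulr_sumr -big_split; apply: eq_bigr => k _ /=.
by have [l1 _] := phiB k.+1 _ B; have [l2 _] := phiB k _ B; rewrite l1 l2 /=; ring.
Qed.

Lemma multiplierB N a b psi x :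
  multiplier N (fun k => a k - b k) psi x =
  multiplier N a psi x - multiplier N b psi x.
Proof.
by rewrite /multiplier -sumrB; apply: eq_bigr => k _; rewrite mulrBl.
Qed.

Lemma multiplierZ N c a psi x :
  multiplier N (fun k => c * a k) psi x = c * multiplier N a psi x.
Proof.
by rewrite /multiplier mulr_sumr; apply: eq_bigr => k _; rewrite mulrA.
Qed.

Lemma multiplier_le N th psi x (s : R) :
  dual_ball psi -> (forall k, `|th k| <= s) ->
  `|multiplier N th psi x| <= `|x| * (2 * s + seq_variation N th).
Proof.
have [_ phiB _ _] := cphi.
move=> B ths.
apply: (@abel_summation_bound _ N `|x| s th (fun k => phi k psi x)) => // k _.
by have [_ b1] := phiB k.+1 _ B; have [_ b2] := phiB k _ B.
Qed.

(* The two ways in which a coordinate block is (almost) invisible: before it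
   starts and after it has ended. *)
Lemma multiplier_low N th psi x (e s : R) K : 0 <= e ->
  (forall k, (k <= K)%N -> `|phi k psi x| <= e) ->
  (forall k, `|th k| <= s) -> (forall k, (K <= k)%N -> th k = 0) ->
  `|multiplier N th psi x| <= e * (2 * s + seq_variation N th).
Proof.
move=> e0 hx ths th0.
apply: (@abel_summation_bound _ N e s th (fun k => phi k psi x)) => // k thk.
have kK : (k < K)%N by rewrite ltnNge; apply: contra_neqN thk; exact: th0.
by split; apply: hx => //; exact: ltnW.
Qed.

Lemma multiplier_high N th psi x (e s : R) K : 0 <= e ->
  (forall k, (K <= k)%N -> `|phi k psi x - psi x| <= e) ->
  (forall k, `|th k| <= s) -> (forall k, (k < K)%N -> th k = 0) ->
  `|multiplier N th psi x| <= e * (2 * s + seq_variation N th).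
Proof.
move=> e0 hx ths th0.
(* Subtracting a constant leaves the increments unchanged and makes the values small from [K] on. *)
pose c k := phi k psi x - psi x.
have -> : multiplier N th psi x = \sum_(k < N) th k * (c k.+1 - c k).
  by apply: eq_bigr => k _; rewrite /c; ring.
apply: abel_summation_bound => // k thk.
have Kk : (K <= k)%N by rewrite leqNgt; apply: contra_neqN thk; exact: th0.
by split; apply: hx => //; exact: leqW.
Qed.

End multipliers.

(** * Paths in the tree of finite sequences *)

(** Up to [e], the values of [A] along [z] are those at finitely many indices; an index beyond all
    of these supplies the second one. *)
Lemma pigeonhole_close {R : realType} {X : normedModType R}
    (A : seq (X -> R)) (z : nat -> X) (C e : R) :
  (forall f, List.In f A -> dual_ball f) -> (forall j, `|z j| <= C) -> 0 < e ->
  exists j j', j <> j' /\ forall f, List.In f A -> `|f (z j - z j')| <= e.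
Proof.
move=> AB zC e0; pose ev (f : X -> R) := f \o z.
have [|D [_ netD]] := @finite_net R nat [seq ev f | f <- A] (fun=> True) e e0.
  move=> g /List.in_map_iff[f [<- /AB[_ fb]]]; exists C => j _ /=.
  exact: le_trans (fb _) (zC j).
(* [(sumn D).+1] exceeds every member of [D]. *)
have [a Da ha] := netD (sumn D).+1 I; exists (sumn D).+1, a; split.
  suff : (a <= sumn D)%N by move=> h E; rewrite -E ltnn in h.
  elim: (D) Da => //= b s IH [->|/IH h]; first exact: leq_addr.
  exact: leq_trans h (leq_addl _ _).
move=> f Af; have [fl _] := AB f Af.
rewrite (scalar_subr fl); apply: (ha (ev f)).
by apply/List.in_map_iff; exists f.
Qed.

Section paths.
Context {R : realType} {X : normedModType R}.
Variable x : nat -> X.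

(** The coding of finite sequences by integers turns the sequence [x] into a system indexed by a
    tree. *)
Definition node (s : seq nat) : X := x (pickle s).

(* [p] is a path in the tree of finite sequences; the sibling obtained by
   replacing the last step by the one of [q] is subtracted from each node. *)
Definition path_sum (c : nat -> R) (p q : seq nat) : X :=
  \sum_(i < size p) c i *:
    (node (rcons (take i p) (nth 0 p i)) - node (rcons (take i p) (nth 0 q i))).

Lemma path_sum_rcons c p q j j' : size q = size p ->
  path_sum c (rcons p j) (rcons q j') =
  path_sum c p q + c (size p) *: (node (rcons p j) - node (rcons p j')).
Proof.
move=> qp; rewrite /path_sum size_rcons big_ord_recr/= -cats1 take_size_cat//.
congr (_ + _ *: _).
  apply: eq_bigr => i _; rewrite take_cat ltn_ord nth_cat ltn_ord.
  by rewrite nth_rcons qp ltn_ord.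
by rewrite !cats1 !nth_rcons qp ltnn eqxx.
Qed.

Definition path_functional (f : nat -> X -> R) (n : nat) (t : nat -> nat)
    (y : X) : R :=
  \sum_(i < n) f (pickle (mkseq t i.+1)) y.

Variables (f : nat -> X -> R) (eta : R).
Hypothesis xf : almost_biorthogonal eta x f.

Lemma path_functional_scalar n t : scalar (path_functional f n t).
Proof.
have [_ fl _ _] := xf => a y z; rewrite /path_functional mulr_sumr -big_split.
by apply: eq_bigr => i _ /=; rewrite fl.
Qed.

Lemma path_functional_le n t y : `|path_functional f n t y| <= n%:R * 2 * `|y|.
Proof.
have [_ _ fb _] := xf; apply: le_trans (ler_norm_sum _ _ _) _.
apply: le_trans (ler_sum _ (fun i _ => fb _ y)) _.
by rewrite sumr_const card_ord -mulrA -[leLHS]mulr_natl.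
Qed.

Lemma path_functional_node n t s j : (size s < n)%N ->
  `|path_functional f n t (node (rcons s j)) -
    (rcons s j == mkseq t (size s).+1)%:R| <= n%:R * eta.
Proof.
move=> sn; have [_ _ _ xfE] := xf.
have -> : (rcons s j == mkseq t (size s).+1)%:R =
    \sum_(i < n) (pickle (rcons s j) == pickle (mkseq t i.+1))%:R :> R.
  (* Codes are injective, so by comparing lengths only the term of index [size s] can match. *)
  rewrite (bigD1 (Ordinal sn))//= (inj_eq (pcan_inj pickleK)) big1 ?addr0//.
  move=> i /eqP i_neq; case: eqP => // /(pcan_inj pickleK) /(congr1 size).
  rewrite size_rcons size_mkseq => -[E]; case: i_neq; exact: val_inj.
rewrite -sumrB; apply: le_trans (ler_norm_sum _ _ _) _.
apply: le_trans (ler_sum _ (fun i _ => xfE _ _)) _.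
by rewrite sumr_const card_ord -[leLHS]mulr_natl.
Qed.

(** The value of branch [t] on the [i]-th difference if biorthogonality were exact. *)
Definition path_sign (p q : seq nat) (t : nat -> nat) (i : nat) : R :=
  (rcons (take i p) (nth 0 p i) == mkseq t i.+1)%:R -
  (rcons (take i p) (nth 0 q i) == mkseq t i.+1)%:R.

Lemma path_functional_path_sum n t c p q : size p = n ->
  (forall i, `|c i| <= 1) ->
  `|path_functional f n t (path_sum c p q) -
    \sum_(i < n) c i * path_sign p q t i| <= n%:R * (n%:R * eta + n%:R * eta).
Proof.
move=> pn c1; rewrite (scalar_sum (path_functional_scalar n t)) pn -sumrB.
apply: le_trans (ler_norm_sum _ _ _) _.
set b := n%:R * eta + _; have -> : n%:R * b = \sum_(i < n) b.
  by rewrite sumr_const card_ord mulr_natl.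
apply: ler_sum => i _; have fl := path_functional_scalar n t.
rewrite (scalar_scaler fl) (scalar_subr fl) -mulrBr normrM.
apply: le_trans (ler_wpM2r (normr_ge0 _) (c1 i)) _; rewrite mul1r.
have ti : size (take i p) = i by rewrite size_take pn ltn_ord.
have := @path_functional_node n t (take i p) (nth 0 p i).
have := @path_functional_node n t (take i p) (nth 0 q i).
rewrite ti => /(_ (ltn_ord i)) h1 /(_ (ltn_ord i)) h2.
move: h1 h2; rewrite /path_sign /b !ler_norml => /andP[? ?] /andP[? ?].
by apply/andP; split; lra.
Qed.

End paths.

Lemma rcons_take_mkseq (p : seq nat) (t : nat -> nat) i j : (i <= size p)%N ->
  (rcons (take i p) j == mkseq t i.+1) = (take i p == mkseq t i) && (j == t i).
Proof.
by move=> ip; rewrite /mkseq -addn1 iotaD map_cat/= add0n cats1 eqseq_rcons.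
Qed.

(** While [t] follows [p] the partial sums alternate between 0 and 1. On leaving [p] it may hit one
    sibling, which adds a single sign, and afterwards it meets nothing. *)
Lemma path_sign_alternating {R : realType} p q t m : (m <= size p)%N ->
  (forall i, (i < size p)%N -> nth 0%N p i <> nth 0%N q i) ->
  `|\sum_(i < m) (-1) ^+ i * path_sign p q t i : R| <= 2.
Proof.
move=> mp pq; pose s k : R := \sum_(i < k) (-1) ^+ i * path_sign p q t i.
rewrite -/(s m).
suff : if take m p == mkseq t m then s m = (odd m)%:R else `|s m| <= 2.
  by case: ifP => // _ ->; rewrite ger0_norm// ler_nat; case: odd.
elim: m mp => [|m IH] mp; first by rewrite take0 /s big_ord0.
have := IH (ltnW mp); rewrite /s big_ord_recr/= -/(s m) /path_sign.
rewrite (take_nth 0%N)// !rcons_take_mkseq 1?ltnW//.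
case: eqP => /= [_ sm|_ sm]; last by rewrite subrr mulr0 addr0.
rewrite sm; case: eqP => [pt|npt].
  have -> /= : (nth 0%N q m == t m) = false.
    by apply/eqP => qt; apply: (pq m mp); rewrite pt qt.
  by rewrite subr0 mulr1 -signr_odd; case: (odd m); rewrite /= ?expr0 ?expr1; lra.
rewrite sub0r -signr_odd; case: (odd m); case: eqP => _ /=;
  by rewrite ?expr0 ?expr1 ler_norml; apply/andP; split; lra.
Qed.

Lemma path_sign_along {R : realType} p q m : (m <= size p)%N ->
  (forall i, (i < size p)%N -> nth 0%N p i <> nth 0%N q i) ->
  \sum_(i < m) 1 * path_sign p q (nth 0%N p) i = m%:R :> R.
Proof.
move=> mp pq; rewrite -[m in RHS]card_ord -sumr_const; apply: eq_bigr => i _.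
have ip : (i < size p)%N by exact: leq_trans (ltn_ord i) mp.
have -> : path_sign p q (nth 0%N p) i = 1 :> R; last by rewrite mul1r.
rewrite /path_sign !rcons_take_mkseq 1?ltnW//.
have -> : take i p = mkseq (nth 0%N p) i.
  apply: (@eq_from_nth _ 0%N); rewrite size_takel ?(ltnW ip) ?size_mkseq// => j ji.
  by rewrite nth_take// nth_mkseq.
rewrite !eqxx (_ : (_ == _) = false) ?subr0//.
by apply/eqP => qt; apply: (pq i ip).
Qed.

(** * Sign switching along a path *)

(** Freezing the sequence at [c] from [K] on costs one jump of size at most 2. *)
Lemma seq_variation_switch {R : realType} N K (d : nat -> R) c :
  (forall k, `|d k| <= 1) -> `|c| <= 1 ->
  seq_variation N (fun k => if (k < K)%N then d k else c) <= seq_variation N d + 2.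
Proof.
move=> d1 c1.
(* For the induction the 2 must be charged only once the jump at [K] has been passed. *)
suff : seq_variation N (fun k => if (k < K)%N then d k else c) <=
    seq_variation N d + (if (N < K)%N then 0 else 2).
  by move/le_trans; apply; rewrite lerD2l; case: ifP => _; lra.
elim: N => [|N IH]; first by rewrite /seq_variation !big_ord0; case: ifP => _; lra.
move: IH; rewrite /seq_variation !big_ord_recr/=.
rewrite -/(seq_variation N _) -/(seq_variation N d).
have [NK|NK] := ltnP N.+1 K; first by rewrite (ltnW NK); lra.
have := normr_ge0 (d N.+1 - d N).
case: ifP => _; last by rewrite subrr normr0; lra.
by have := le_trans (ler_normB c (d N)) (lerD c1 (d1 N)); lra.
Qed.

(* Along the path the images of the nodes are successive almost blocks, so a
   single multiplier [d] of small variation switches all the signs. *)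
Lemma almost_block_path {R : realType} {X : normedModType R}
    (phi : nat -> (X -> R) -> X -> R) (x : nat -> X) (T : {linear X -> X})
    (C : R) (n : nat) (e : R) :
  coarsening phi -> (forall m, `|T (x m)| <= C) -> 0 < e ->
  forall i, (i <= n)%N -> exists p q (d : nat -> R),
  [/\ size p = i, size q = i,
      forall l, (l < i)%N -> nth 0%N p l <> nth 0%N q l,
      (forall k, `|d k| <= 1) /\ (forall N, seq_variation N d <= 2 * i%:R) &
      forall N th psi, dual_ball psi -> (forall k, `|th k| <= 1) ->
        seq_variation N th <= 2 * n%:R ->
        `|multiplier phi N th psi (T (path_sum x (fun=> 1) p q)) -
          multiplier phi N (fun k => th k * d k) psi
            (T (path_sum x (fun l => (-1) ^+ l) p q))| <= i%:R * e].
Proof.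
move=> cphi TC e0; elim=> [|i IH] i_n.
  exists [::], [::], (fun=> 1); split=> //.
    by split=> [k|N]; rewrite ?normr1// /seq_variation mulr0 big1// => k _;
      rewrite subrr normr0.
  move=> N th psi B _ _; rewrite /path_sum !big_ord0 linear0 mul0r.
  have ml th' := multiplier_scalar cphi N th' B.
  have m0 th' : multiplier phi N th' psi 0 = 0.
    by have := scalar_subr (ml th') 0 0; rewrite subrr => ->; rewrite subrr.
  by rewrite !m0 subrr normr0.
have [p [q [d [pi qi pq [d1 dv] hd]]]] := IH (ltnW i_n).
set z := path_sum x (fun=> 1) p q in hd.
set z' := path_sum x (fun l => (-1) ^+ l) p q in hd.
(* Each step makes two errors of size [e' * (4 + 8 * n%:R)], which add up to [e]. *)
pose e' := e / (8 + 16 * n%:R).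
have n0 : 0 <= n%:R :> R by [].
have e'0 : 0 < e' by rewrite divr_gt0//; lra.
have [_ _ _ phic] := cphi.
(* From level [K] on, [T z'] has almost ended, uniformly over the dual ball. *)
have [K hK] := phic (T z') e' e'0.
have [A [AB inA]] := coarsening_finite_range K cphi.
(* Two of the infinitely many extensions of [p] have images hardly separated by [A], so their
   difference is almost invisible up to level [K]. *)
have [|j [j' [jj' hj]]] :=
  @pigeonhole_close R X A (fun j => T (node x (rcons p j))) C e' AB _ e'0.
  by move=> j; exact: TC.
pose c : R := (-1) ^+ i.
have c1 : `|c| = 1 by rewrite normrX normrN1 expr1n.
have cc : c * c = 1 by rewrite -expr2 -exprM mulnC exprM sqrrN expr1n expr1n.
(* The old signs are kept where [T z'] lives; the new sign [c] is used where the new block lives. *)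
pose d' k := if (k < K)%N then d k else c.
have d'1 k : `|d' k| <= 1 by rewrite /d'; case: ifP => // _; rewrite c1.
exists (rcons p j), (rcons q j'), d'; split; rewrite ?size_rcons ?pi ?qi//.
- move=> l; rewrite ltnS leq_eqVlt !nth_rcons pi qi.
  case: eqP => [-> _|_ /= li]; first by rewrite ltnn.
  by rewrite li; exact: pq.
- split=> // N; apply: le_trans (seq_variation_switch N K d1 _) _; first by rewrite c1.
  by have := dv N; rewrite -natr1; lra.
move=> N th psi B th1 thn; rewrite !path_sum_rcons ?pi ?qi// -/z -/z' -/c scale1r.
set y := node x _ - node x _ in hj *.
rewrite (linearD T z) (linearD T z') (linearZ_LR T c).
have ml th' := multiplier_scalar cphi N th' B.
rewrite !(scalar_addr (ml _)) (scalar_scaler (ml _)).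
have thd1 k : `|th k * d k| <= 1 by rewrite normrM mulr_ile1.
have thd'1 k : `|th k * d' k| <= 1 by rewrite normrM mulr_ile1.
have vd' : seq_variation N d' <= 2 * i%:R + 2.
  apply: le_trans (seq_variation_switch N K d1 _) _; first by rewrite c1.
  by rewrite lerD2r.
have vthd : seq_variation N (fun k => th k * d k) <= 2 * n%:R + 2 * i%:R.
  by apply: le_trans (seq_variationM _ th1 d1) _; rewrite lerD.
have vthd' : seq_variation N (fun k => th k * d' k) <= 2 * n%:R + (2 * i%:R + 2).
  by apply: le_trans (seq_variationM _ th1 d'1) _; rewrite lerD.
have i_n' : i%:R + 1 <= n%:R :> R by rewrite natr1 ler_nat.
have old := hd N th psi B th1 thn.
(* The two multipliers agree below [K], and [T z'] has almost ended there. *)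
have high : `|multiplier phi N (fun k => th k * d k) psi (T z') -
    multiplier phi N (fun k => th k * d' k) psi (T z')| <= e' * (4 + 8 * n%:R).
  rewrite -multiplierB.
  apply: le_trans (multiplier_high (s := 2) (K := K) N (ltW e'0) _ _ _) _.
  - by move=> k Kk; exact: hK.
  - by move=> k; apply: le_trans (ler_normB _ _) _; have := thd1 k; have := thd'1 k; lra.
  - by move=> k kK; rewrite /d' kK subrr.
  rewrite ler_pM2l//.
  have := seq_variationB N (fun k => th k * d k) (fun k => th k * d' k).
  lra.
(* From [K] on the coefficients agree because [c * c = 1]; below [K] the new block has not
   started. *)
have low : `|multiplier phi N th psi (T y) -
    c * multiplier phi N (fun k => th k * d' k) psi (T y)| <= e' * (4 + 8 * n%:R).
  rewrite -multiplierZ -multiplierB.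
  apply: le_trans (multiplier_low (s := 2) (K := K) N (ltW e'0) _ _ _) _.
  - by move=> k kK; rewrite /y linearB; apply: hj; exact: inA.
  - move=> k; apply: le_trans (ler_normB _ _) _; rewrite normrM c1 mul1r.
    by have := th1 k; have := thd'1 k; lra.
  - by move=> k Kk; rewrite /d' ltnNge Kk/= mulrCA cc mulr1 subrr.
  rewrite ler_pM2l//.
  have := seq_variationB N th (fun k => c * (th k * d' k)).
  by rewrite seq_variationZ c1 mul1r; lra.
have -> : i.+1%:R * e = i%:R * e + e' * (4 + 8 * n%:R) + e' * (4 + 8 * n%:R).
  rewrite -natr1 /e'; field; apply/eqP; lra.
move: old high low; rewrite !ler_norml => /andP[? ?] /andP[? ?] /andP[? ?].
by apply/andP; split; lra.
Qed.

(** * Equivalent norms given by families of functionals *)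

Section family_norm.
Context {R : realType} {X : normedModType R}.

Definition norming_family (L : set (X -> R)) : Prop :=
  [/\ forall l, L l -> scalar l,
      exists b : R, forall l y, L l -> `|l y| <= b * `|y| &
      exists2 a : R, 0 < a & forall y, exists2 l, L l & a * `|y| <= `|l y|].

Definition family_norm (L : set (X -> R)) (y : X) : R :=
  sup [set `|l y| | l in L].

Variables (L : set (X -> R)) (nL : norming_family L).

Lemma family_norm_ge l y : L l -> `|l y| <= family_norm L y.
Proof.
have [_ [b hb] _] := nL; move=> Ll; apply: ub_le_sup; last by exists l.
by exists (b * `|y|) => _ [k Lk <-]; exact: hb.
Qed.

Lemma family_norm_le (y : X) (c : R) :
  (forall l, L l -> `|l y| <= c) -> family_norm L y <= c.
Proof.
have [_ _ [a _ ha]] := nL; move=> h; apply: ge_sup; last by move=> _ [l Ll <-]; exact: h.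
by have [l Ll _] := ha 0; exists `|l y|, l.
Qed.

Lemma family_normD y z : family_norm L (y + z) <= family_norm L y + family_norm L z.
Proof.
have [Ls _ _] := nL; apply: family_norm_le => l Ll.
rewrite (scalar_addr (Ls l Ll)); apply: le_trans (ler_normD _ _) _.
by rewrite lerD// family_norm_ge.
Qed.

Lemma family_normZ (a : R) y : family_norm L (a *: y) = `|a| * family_norm L y.
Proof.
have [Ls _ _] := nL.
have le c z : family_norm L (c *: z) <= `|c| * family_norm L z.
  apply: family_norm_le => l Ll; rewrite (scalar_scaler (Ls l Ll)) normrM.
  by rewrite ler_wpM2l// family_norm_ge.
apply/eqP; rewrite eq_le le/=; have [->|a0] := eqVneq a 0.
  rewrite normr0 mul0r scale0r; have [_ _ [b _ hb]] := nL.
  by have [l Ll _] := hb 0; exact: le_trans (normr_ge0 _) (family_norm_ge 0 Ll).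
rewrite -ler_pdivlMl ?normr_gt0//.
by have := le a^-1 (a *: y); rewrite scalerA mulVf// scale1r normfV.
Qed.

Lemma family_norm_equiv : exists a b : R,
  [/\ 0 < a, 0 < b, forall y, a * `|y| <= family_norm L y &
      forall y, family_norm L y <= b * `|y|].
Proof.
have [_ [b hb] [a a0 ha]] := nL; exists a, (`|b| + 1); split=> //.
- by move=> y; have [l Ll h] := ha y; exact: le_trans h (family_norm_ge _ Ll).
- move=> y; apply: family_norm_le => l Ll; apply: le_trans (hb _ _ Ll) _.
  by rewrite ler_wpM2r//; have := ler_norm b; lra.
Qed.

End family_norm.

(** * The two renormings *)

Section distortion.
Context {R : realType} {X : normedModType R}.
Variables (phi : nat -> (X -> R) -> X -> R) (n : nat).
Hypotheses (cphi : coarsening phi) (n0 : (0 < n)%N).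

(** Lower bound: the constant multiplier 1 telescopes to [phi N psi], which for [psi] norming [y]
    and large [N] keeps half of the norm of [y]. *)
Lemma multipliers_norming : norming_family (multipliers phi n).
Proof.
have [phi0 _ _ phic] := cphi; split.
- by move=> _ [N [th [psi [B _ _ ->]]]]; exact: multiplier_scalar.
- exists (2 + 2 * n%:R) => _ y [N [th [psi [B th1 thn ->]]]].
  apply: le_trans (multiplier_le cphi N y B th1) _.
  by rewrite mulrC ler_wpM2r//; lra.
exists (1 / 2) => [|y]; first by rewrite divr_gt0.
have [psi B psiy] := norming_functional y.
have [->|y0] := eqVneq y 0.
  exists (multiplier phi 0 (fun=> 0) psi); last by rewrite normr0 mulr0.
  exists 0%N, (fun=> 0), psi; split=> // [k|]; first by rewrite normr0.
  by rewrite /seq_variation big_ord0 mulr_ge0.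
have [|N hN] := phic y (`|y| / 2); first by rewrite divr_gt0// normr_gt0.
exists (multiplier phi N (fun=> 1) psi).
  exists N, (fun=> 1), psi; split=> // [k|]; first by rewrite normr1.
  by rewrite /seq_variation big1 ?mulr_ge0// => k _; rewrite subrr normr0.
have -> : multiplier phi N (fun=> 1) psi y = phi N psi y.
  rewrite /multiplier -(big_mkord xpredT (fun k => 1 * (phi k.+1 psi y - phi k psi y))).
  under eq_bigr do rewrite mul1r.
  by rewrite telescope_sumr// phi0 subr0.
have := hN N psi (leqnn _) B; rewrite psiy ler_norml => /andP[h _].
by apply: le_trans (ler_norm _); lra.
Qed.

Variables (x : nat -> X) (f : nat -> X -> R).
Hypothesis xf : almost_biorthogonal (2 * n%:R ^+ 2)^-1 x f.

(** The multiples of the dual ball make the norm equivalent to the original one; their factor is so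
    small that they contribute at most 1 on path sums. *)
Definition path_functionals : set (X -> R) :=
  [set l | (exists t, l = path_functional f n t) \/
           exists2 psi, dual_ball psi & l = fun y => (2 * n%:R)^-1 * psi y].

Let n_gt0 : 0 < n%:R :> R. Proof. by rewrite ltr0n. Qed.

Lemma path_functionals_norming : norming_family path_functionals.
Proof.
split.
- move=> _ [[t ->]|[psi [psil _] ->]]; first exact: (path_functional_scalar xf).
  by move=> a y z /=; rewrite psil /=; ring.
- exists (n%:R * 2 + (2 * n%:R)^-1) => l y; rewrite mulrDl => -[[t ->]|[psi [_ psib] ->]].
    by rewrite ler_wpDr ?mulr_ge0 ?invr_ge0 ?mulr_ge0// (path_functional_le xf).
  rewrite ler_wpDl ?mulr_ge0// normrM ger0_norm ?invr_ge0 ?mulr_ge0//.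
  by rewrite ler_wpM2l// invr_ge0 mulr_ge0.
exists (2 * n%:R)^-1 => [|y]; first by rewrite invr_gt0 mulr_gt0.
have [psi B psiy] := norming_functional y.
exists (fun y => (2 * n%:R)^-1 * psi y); first by right; exists psi.
by rewrite psiy ler_norm.
Qed.

Lemma path_sum_norm_le (c : nat -> R) p q : size p = n ->
  (forall i, `|c i| <= 1) -> `|path_sum x c p q| <= 2 * n%:R.
Proof.
have [x1 _ _ _] := xf => pn c1; apply: le_trans (ler_norm_sum _ _ _) _.
have -> : 2 * n%:R = \sum_(i < size p) (2 : R).
  by rewrite sumr_const card_ord pn mulr_natr.
apply: ler_sum => i _; rewrite normrZ -[2]mul1r ler_pM//.
by apply: le_trans (ler_normB _ _) _; rewrite /node !x1.
Qed.

(** The accuracy of the biorthogonal system is chosen so that the total error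
    [n%:R * (n%:R * eta + n%:R * eta)] is exactly 1. *)
Let path_functional_sum t c p q : size p = n -> (forall i, `|c i| <= 1) ->
  `|path_functional f n t (path_sum x c p q) -
    \sum_(i < n) c i * path_sign p q t i| <= 1.
Proof.
move=> pn c1; apply: le_trans (path_functional_path_sum xf t q pn c1) _.
by rewrite le_eqVlt; apply/orP; left; apply/eqP; field; rewrite lt0r_neq0.
Qed.

(** On a branch, 2 comes from the exact signs and 1 from the error of biorthogonality. *)
Lemma path_norm_alternating p q : size p = n ->
  (forall i, (i < n)%N -> nth 0%N p i <> nth 0%N q i) ->
  family_norm path_functionals (path_sum x (fun l => (-1) ^+ l) p q) <= 3.
Proof.
move=> pn pq; have c1 i : `|(-1) ^+ i : R| <= 1 by rewrite normrX normrN1 expr1n.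
apply: (family_norm_le path_functionals_norming) => _ [[t ->]|[psi [_ psib] ->]].
  have := path_functional_sum t q pn c1.
  have := @path_sign_alternating R p q t n; rewrite pn => /(_ (leqnn _) pq).
  rewrite !ler_norml => /andP[? ?] /andP[? ?]; apply/andP; split; lra.
rewrite normrM ger0_norm ?invr_ge0 ?mulr_ge0// ler_pdivrMl ?mulr_gt0//.
by have := n_gt0; have := le_trans (psib _) (path_sum_norm_le q pn c1); lra.
Qed.

(** The branch along [p] itself meets every node and no sibling. *)
Lemma path_norm_sum p q : size p = n ->
  (forall i, (i < n)%N -> nth 0%N p i <> nth 0%N q i) ->
  n%:R - 1 <= family_norm path_functionals (path_sum x (fun=> 1) p q).
Proof.
move=> pn pq.
have Fp : path_functionals (path_functional f n (nth 0%N p)).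
  by left; exists (nth 0%N p).
apply: le_trans _ (family_norm_ge path_functionals_norming _ Fp).
apply: le_trans _ (ler_norm _).
have c1 (i : nat) : `|1 : R| <= 1 by rewrite normr1.
have := path_functional_sum (nth 0%N p) q pn c1.
have := @path_sign_along R p q n; rewrite pn => /(_ (leqnn _) pq) ->.
by rewrite ler_norml lerBrDr addrC => /andP[].
Qed.

(** The 7 is 2 * 3 + 1: the factor 2 of unconditionality, the bound 3 for the alternating sum, and a
    total block error of [F]. *)
Lemma distortion_lower_bound (T : {linear X -> X}) (F G : R) :
  0 < F -> 0 <= G ->
  (forall y, family_norm (multipliers phi n) (T y) <=
             F * family_norm path_functionals y) ->
  (forall y, family_norm path_functionals y <=
             G * family_norm (multipliers phi n) (T y)) ->
  n%:R - 1 <= 7 * (F * G).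
Proof.
move=> F0 G0 TF TG.
have nU := multipliers_norming; have nQ := path_functionals_norming.
have [a [_ [a0 _ aU _]]] := family_norm_equiv nU.
have [_ [b [_ b0 _ bQ]]] := family_norm_equiv nQ.
have [x1 _ _ _] := xf.
have Tx m : `|T (x m)| <= a^-1 * (F * b).
  rewrite ler_pdivlMl//; apply: le_trans (aU _) _; apply: le_trans (TF _) _.
  by rewrite ler_pM2l//; apply: le_trans (bQ _) _; rewrite x1 mulr1.
(* With this error per step, the [n] steps cost [F] in all. *)
have e0 : 0 < F / n%:R by rewrite divr_gt0.
have [p [q [d [pn qn pq [d1 dv] hd]]]] :=
  almost_block_path cphi Tx e0 (leqnn n).
set z := path_sum x _ p q in hd; set z' := path_sum x _ p q in hd.
have Uz : family_norm (multipliers phi n) (T z) <=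
    2 * family_norm (multipliers phi n) (T z') + F.
  apply: (family_norm_le nU) => _ [N [th [psi [B th1 thn ->]]]].
  have := hd N th psi B th1 thn.
  rewrite [n%:R * _]mulrC divfK ?lt0r_neq0// => h.
  have thd1 k : `|th k * d k| <= 1 by rewrite normrM mulr_ile1.
  (* Both [th] and [d] have variation at most [2 * n%:R], so half of their product is admissible
     again. *)
  have : multipliers phi n (multiplier phi N (fun k => 2^-1 * (th k * d k)) psi).
    exists N, (fun k => 2^-1 * (th k * d k)), psi; split=> // [k|].
      by rewrite normrM ger0_norm// mulr_ile1// invf_le1// ler1n.
    rewrite seq_variationZ ger0_norm// ler_pdivrMl//.
    apply: le_trans (seq_variationM _ th1 d1) _.
    by have := dv N; lra.
  move=> /(family_norm_ge nU (T z')); rewrite multiplierZ normrM ger0_norm//.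
  rewrite ler_pdivrMl// => h2.
  have := ler_normD (multiplier phi N th psi (T z) -
    multiplier phi N (fun k => th k * d k) psi (T z'))
    (multiplier phi N (fun k => th k * d k) psi (T z')).
  by rewrite subrK; lra.
have Qz := path_norm_sum pn pq; have Qz' := path_norm_alternating pn pq.
apply: le_trans Qz _; apply: le_trans (TG _) _.
rewrite mulrA [leRHS]mulrC ler_wpM2l//; apply: le_trans Uz _.
have := TF z'; have : F * family_norm path_functionals z' <= F * 3.
  by rewrite ler_pM2l.
lra.
Qed.

End distortion.

Lemma bounded_linear_cont {R : realType} {V W : normedModType R} (f : {linear V -> W}) (c : R) :
  (forall y, `|f y| <= c * `|y|) -> continuous f.
Proof.
move=> fc; apply: bounded_linear_continuous; apply/linear_boundedP.
exists c; split; first exact: num_real.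
move=> r cr y; apply: le_trans (fc y) _; rewrite ler_wpM2r//; exact: ltW.
Qed.

(** * The renormed spaces as Banach spaces *)

Section renormed.
Context {R : realType} {X : completeNormedModType R}.

(** An alias of [X] indexed by [nL], so that the new norm does not clash with the original one. *)
Definition renormed (L : set (X -> R)) (nL : norming_family L) : Type := X.

Variables (L : set (X -> R)) (nL : norming_family L).

HB.instance Definition _ := GRing.Lmodule.copy (renormed nL) X.

Let family_norm_eq0 (y : renormed nL) : family_norm L y = 0 -> y = 0.
Proof.
have [a [_ [a0 _ aL _]]] := family_norm_equiv nL => y0; apply/eqP.
rewrite -normr_le0; have := aL y; rewrite y0 pmulr_rle0//.
Qed.

HB.instance Definition _ := Lmodule_isNormed.Build R (renormed nL)
  (family_normD nL) (family_normZ nL) family_norm_eq0.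

Lemma renormed_normE (y : renormed nL) : `|y| = family_norm L y.
Proof. by []. Qed.

Lemma renormed_complete (F : set_system (renormed nL)) :
  ProperFilter F -> cauchy F -> cvg F.
Proof.
move=> FF Fc; have [a [b [a0 b0 aL bL]]] := family_norm_equiv nL.
have cX : @cauchy X F.
  apply/(@cauchy_ballP R X) => e e0.
  have /cauchy_ballP/(_ (a * e)) := Fc; move/(_ (mulr_gt0 a0 e0)).
  apply: filterS => -[y z] /=; rewrite -!ball_normE/= renormed_normE => h.
  by rewrite -(ltr_pM2l a0); exact: le_lt_trans (aL _) h.
have /cvg_ex[l Fl] := @cauchy_cvg X F FF cX.
apply/cvg_ex; exists (l : renormed nL).
apply/(@fcvg_ballP R (renormed nL)) => e e0.
have /(@fcvg_ballP R X)/(_ (b^-1 * e)) := Fl.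
rewrite mulr_gt0 ?invr_gt0// => /(_ isT); apply: filterS => y.
rewrite -!ball_normE/= renormed_normE => h.
by apply: le_lt_trans (bL _) _; rewrite -ltr_pdivlMl.
Qed.

HB.instance Definition _ := Uniform_isComplete.Build (renormed nL) renormed_complete.

Lemma isomorphic_renormed : isomorphic X (renormed nL).
Proof.
have [a [b [a0 b0 aL bL]]] := family_norm_equiv nL.
pose u : X -> renormed nL := id; pose v : renormed nL -> X := id.
have ul : linear u by []. have vl : linear v by [].
pose U : {linear X -> renormed nL} := HB.pack u (GRing.isLinear.Build _ _ _ _ u ul).
pose V : {linear renormed nL -> X} := HB.pack v (GRing.isLinear.Build _ _ _ _ v vl).
exists u, v; split=> //; split=> //; split=> //; split.
  exact: (bounded_linear_cont (f := U) bL).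
apply: (bounded_linear_cont (f := V) (c := a^-1)) => y.
by rewrite ler_pdivlMl//; exact: aL.
Qed.

End renormed.

(** * The distance between the two renormings *)

Section operator_norm.
Context {R : realType} {V W : normedModType R} (f : V -> W).
Hypothesis fl : linear f.

Let fL : {linear V -> W} := HB.pack f (GRing.isLinear.Build R V W *:%R f fl).

Let f0 : f 0 = 0. Proof. exact: (linear0 fL). Qed.

Let fZ a y : f (a *: y) = a *: f y. Proof. exact: (linearZ_LR fL). Qed.

Lemma opnorm_ge y : `|y| <= 1 -> ((`|f y|)%:E <= opnorm f)%E.
Proof. by move=> y1; apply: ereal_sup_ubound; exists y. Qed.

Lemma opnorm_bound : opnorm f \is a fin_num ->
  forall y, `|f y| <= fine (opnorm f) * `|y|.
Proof.
move=> ffin y; have [->|y0] := eqVneq y 0.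
  by rewrite f0 !normr0 mulr0.
have ny : 0 < `|y| by rewrite normr_gt0.
have /opnorm_ge : `| (`|y|^-1 *: y) | <= 1.
  by rewrite normrZ normfV normr_id mulVf ?lt0r_neq0.
rewrite -(fineK ffin) lee_fin fZ normrZ normfV normr_id.
by rewrite ler_pdivrMl// mulrC.
Qed.

Lemma opnorm_gt0 y : f y <> 0 -> (0 < opnorm f)%E.
Proof.
move=> fy; have y0 : y != 0.
  by apply/eqP => y0; apply: fy; rewrite y0 f0.
have ny : 0 < `|y| by rewrite normr_gt0.
apply: lt_le_trans (opnorm_ge (y := `|y|^-1 *: y) _).
  by rewrite lte_fin fZ normrZ mulr_gt0 ?normr_gt0 ?invr_eq0 ?lt0r_neq0//; exact/eqP.
by rewrite normrZ normfV normr_id mulVf ?lt0r_neq0.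
Qed.

End operator_norm.

(** The nonzero vector makes both operator norms positive, so an infinite one makes the product
    infinite; otherwise both are real constants. *)
Lemma opnorm_mul_ge {R : realType} {V W : normedModType R} (f : V -> W)
    (g : W -> V) (y0 : V) (K : R) : lin_iso f g -> y0 <> 0 ->
  (forall F G : R, 0 < F -> 0 < G -> (forall y, `|f y| <= F * `|y|) ->
     (forall z, `|g z| <= G * `|z|) -> K <= F * G) ->
  (K%:E <= opnorm f * opnorm g)%E.
Proof.
move=> [fl [fg [gf _]]] y00 h.
have f0 : f 0 = 0 by have := fl (-1) 0 0; rewrite scaleN1r oppr0 addr0 scaleN1r addNr.
have gl : linear g.
  by move=> a u v; rewrite -{1}(gf u) -{1}(gf v) -fl fg.
have of0 : (0 < opnorm f)%E.
  by apply: (opnorm_gt0 fl (y := y0)) => fy; apply: y00; rewrite -(fg y0) fy -f0 fg.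
have og0 : (0 < opnorm g)%E.
  by apply: (opnorm_gt0 gl (y := f y0)); rewrite fg.
have [ff|] := boolP (opnorm f \is a fin_num); last first.
  by rewrite fin_numE negb_and !negbK gt_eqF ?(lt_trans (ltNyr 0))//= => /eqP->;
    rewrite gt0_mulye// leey.
have [gg|] := boolP (opnorm g \is a fin_num); last first.
  by rewrite fin_numE negb_and !negbK gt_eqF ?(lt_trans (ltNyr 0))//= => /eqP->;
    rewrite gt0_muley// leey.
rewrite -(fineK ff) -(fineK gg) -EFinM lee_fin; apply: h.
- by rewrite -lte_fin fineK.
- by rewrite -lte_fin fineK.
- exact: (opnorm_bound fl).
- exact: (opnorm_bound gl).
Qed.

Lemma bm_dist_renormed_ge {R : realType} {X : completeNormedModType R} (n : nat) :
  @separable X -> ~ finite_dimensional X -> (0 < n)%N ->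
  exists X1 X2 : completeNormedModType R, [/\ isomorphic X X1, isomorphic X X2 &
    ((((n%:R - 1) / 7 : R)%:E) <= bm_dist X1 X2)%E].
Proof.
move=> sepX infX n0; have [phi cphi] := coarsening_exists sepX.
have eta0 : 0 < (2 * n%:R ^+ 2)^-1 :> R.
  by rewrite invr_gt0 mulr_gt0// exprn_gt0// ltr0n.
have [x [f xf]] := almost_biorthogonal_exists cphi infX eta0.
have nQ := path_functionals_norming n0 xf; have nU := multipliers_norming n cphi.
exists (renormed nQ), (renormed nU); split; try exact: isomorphic_renormed.
apply: le_ereal_inf_tmp => _ [T [S [TS ->]]].
have [Tl [ST [_ _]]] := TS.
have x0 : x 0%N <> 0.
  by move=> xE; have [+ _ _ _] := xf => /(_ 0%N);
    rewrite xE normr0 => /esym/eqP; rewrite oner_eq0.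
apply: (opnorm_mul_ge (y0 := x 0%N : renormed nQ) TS x0) => F G F0 G0 TF SG.
rewrite ler_pdivrMr// mulrC.
(* Both renormed spaces have carrier [X], so [T] can be read as a linear self-map of [X]. *)
pose T' : X -> X := T.
have T'l : linear T' by [].
pose TL : {linear X -> X} := HB.pack T' (GRing.isLinear.Build R X X *:%R T' T'l).
apply: (distortion_lower_bound cphi n0 xf (T := TL) F0 (ltW G0)) => y; first exact: TF.
by have := SG (T y); rewrite ST.
Qed.

Theorem mainTheorem1 (R : realType) (X : completeNormedModType R) :
  @separable X -> ~ finite_dimensional X -> BM_D X = +oo%E.
Proof.
move=> sepX infX; apply/eqyP => K K0.
(* Then [n - 1] is the truncation plus one, which exceeds [7 * K]. *)
pose n := (Num.truncn (7 * K)).+2.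
have [X1 [X2 [i1 i2 h]]] := bm_dist_renormed_ge sepX infX (ltn0Sn _ : 0 < n)%N.
apply: le_trans (ereal_sup_ubound _); last by exists X1, X2.
apply: le_trans h; rewrite lee_fin ler_pdivlMr// mulrC.
rewrite /n -(natr1 (Num.truncn (7 * K)).+1) addrK; apply: ltW; exact: truncnS_gt.
Qed.
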